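(* Let $\{(w^k,x^k)\}$ be the sequence generated by algorithm PSNP or PCSNP with $\alpha_k\equiv\alpha\in\left(0,\min\{\tau,\frac{1}{\sigma+\sigma_0}\}\right]$. If $f$ is $LC^1$ on $\mathbb{N}(0,c_0)$ and, when $q=0$, $f$ is coercive, then $\{F(x^k)\}$ converges, $w^k-x^k\to0$, $x^{k+1}-x^k\to0$, and any accumulation point $x^*$ of $\{x^k\}$ is a P-stationary point with constant $\alpha$, i.e. $x^*\in\mathrm{Prox}_{\alpha\lambda\|\cdot\|_q^q}(x^*-\alpha\nabla f(x^* ))$.
   Context: Problem: $f:\mathbb{R}^n\to\mathbb{R}$ is continuously differentiable and bounded from below, $\lambda>0$, $q\in[0,1)$, and $F(x):=f(x)+\lambda\|x\|_q^q$ with $\|x\|_q^q:=\sum_i|x_i|^q$, where $|t|^0=1$ for $t\ne0$ and $|0|^0=0$. $\|\cdot\|$ is the Euclidean/spectral norm. $\mathrm{supp}(x)$ is the set of indices of nonzero entries; $x_T$ denotes the sub-vector indexed by $T$, $H_T$ the principal sub-matrix indexed by $T$, $\overline T$ the complement of $T$. $\mathbb{N}(x,\epsilon):=\{w:\|x-w\|^2<\epsilon\}$. $f$ is coercive if $f(x)\to\infty$ as $\|x\|\to\infty$. $LC^1$: $f$ is $LC^1$ on an open set $\Omega$ if it is continuously differentiable and $\nabla f$ is Lipschitz on $\Omega$ (with some constant $L$). Generalized Hessian: $\partial^2 g(x)$ is the convex hull of all $H=\lim\nabla^2g(x^i)$ over sequences $x^i\to x$ of points at which $g$ is twice differentiable.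 $E(x;T):=f(x)+\lambda\|x_T\|_q^q$; for $S=\mathrm{supp}(x)$, $\nabla_SE(x):=(\nabla E(\cdot;S)(x))_S$ and $\partial^2_SE(x):=\{M_S:M\in\partial^2E(\cdot;S)(x)\}$. $\mathrm{Prox}_{r}(z):=\operatorname{argmin}_{w}\frac12\|z-w\|^2+r(w)$ (set of global minimizers). Constants: for the initial point $x^0$ and a given $\tau>0$, $\Omega^0:=\{x:F(x)\le F(x^0)\}$, $c_0:=\sup_{x\in\Omega^0}5(\|x\|^2+\tau^2\|\nabla f(x)\|^2+\tau\lambda\|x\|_q^q)$, $\sigma_0:=\sup_{x\in\mathbb{N}(0,c_0)}\sup_{H\in\partial^2f(x)}\|H\|$. Algorithm PSNP: given $x^0\in\mathbb{R}^n$, $\sigma>0$, $\gamma\in(0,1)$, for $k=0,1,2,\dots$: (i) take $w^k\in\mathrm{Prox}_{\alpha_k\lambda\|\cdot\|_q^q}(x^k-\alpha_k\nabla f(x^k))$ and set $S^k=\mathrm{supp}(w^k)$; the step $\alpha_k$ is to be such that $F(w^k)\le F(x^k)-\frac\sigma4\|w^k-x^k\|^2$ (this holds for the choice of $\alpha_k$ above); (ii) choose $M^k\in\partial^2_{S^k}E(w^k)$; if the equations $M^kd^k_{S^k}=\nabla_{S^k}E(w^k)$, $d^k_{\overline{S^k}}=0$ have a solution $d^k$ and a finite integer $s_k$ is found with $F(w^k-\gamma^{s_k}d^k)\le F(w^k)-\frac\sigma2\|\gamma^{s_k}d^k\|^2$, set $\beta_k=\gamma^{s_k}$ and $x^{k+1}=w^k-\beta_kd^k$;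 otherwise set $x^{k+1}=w^k$. Algorithm PCSNP is the same except that step (ii) is tried only when $S^k=\mathrm{supp}(x^k)$; otherwise $x^{k+1}=w^k$. Standing assumption: $\nabla f(0)\neq0$ and $\lambda<\frac{\alpha^{1-q}}{2}\|\nabla f(0)\|_\infty^{2-q}$. *)

(* Defs.v *)
From HB Require Import structures.
From mathcomp Require Import all_boot all_order all_algebra.
From mathcomp Require Import all_classical all_reals all_analysis.

Set Implicit Arguments.
Unset Strict Implicit.
Unset Printing Implicit Defensive.

Import Order.TTheory GRing.Theory Num.Theory.
Import numFieldNormedType.Exports.

Local Open Scope classical_set_scope.
Local Open Scope ring_scope.

(* Vectors of R^n are columns 'cV[R]_n.  Their library norm `|x| is the
   sup norm, so the Euclidean norm is defined here; both induce the same
   topology and the same notion of differentiability. *)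
Definition enorm (R : realType) (n : nat) (x : 'cV[R]_n) : R :=
  Num.sqrt (\sum_(i < n) x i 0 ^+ 2).

(* Spectral norm: the operator norm induced by the Euclidean norm. *)
Definition specnorm (R : realType) (n : nat) (H : 'M[R]_n) : R :=
  sup [set enorm (H *m v) | v in [set v : 'cV[R]_n | enorm v <= 1]].

(* ||x||_q^q.  Zero entries are left out of the sum because 0 `^ 0 = 1 in the
   library, whereas |0|^0 = 0 is wanted; for q > 0 they contribute 0 anyway. *)
Definition lq (R : realType) (q : R) (n : nat) (x : 'cV[R]_n) : R :=
  \sum_(i < n | x i 0 != 0) `|x i 0| `^ q.

Definition supp (R : realType) (n : nat) (x : 'cV[R]_n) : {set 'I_n} :=
  [set i : 'I_n | x i 0 != 0]%SET.

(* x_T and H_T, with the elements of T listed in increasing order. *)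
Definition subvec (R : realType) (n : nat) (T : {set 'I_n}) (x : 'cV[R]_n) :
    'cV[R]_#|T| :=
  rowsub (fun k : 'I_#|T| => enum_val k) x.

Definition principal_submx (R : realType) (n : nat) (T : {set 'I_n})
    (H : 'M[R]_n) : 'M[R]_#|T| :=
  mxsub (fun k : 'I_#|T| => enum_val k) (fun k : 'I_#|T| => enum_val k) H.

(* N(x, eps) = {w : ||x - w||^2 < eps}; note the square. *)
Definition nbhd (R : realType) (n : nat) (x : 'cV[R]_n) (eps : R) :
    set 'cV[R]_n :=
  [set w | enorm (x - w) ^+ 2 < eps].

(* Meaningful where g is differentiable. *)
Definition grad (R : realType) (n : nat) (g : 'cV[R]_n -> R) (x : 'cV[R]_n) :
    'cV[R]_n :=
  \col_(i < n) 'D_(delta_mx i 0) g x.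

Definition continuously_differentiable_on (R : realType) (n : nat)
    (Omega : set 'cV[R]_n) (g : 'cV[R]_n -> R) : Prop :=
  forall x, Omega x -> differentiable g x /\ {for x, continuous (grad g)}.

Definition LC1 (R : realType) (n : nat) (Omega : set 'cV[R]_n)
    (g : 'cV[R]_n -> R) : Prop :=
  continuously_differentiable_on Omega g /\
  exists L : R, forall x y, Omega x -> Omega y ->
    enorm (grad g x - grad g y) <= L * enorm (x - y).

Definition bounded_from_below (R : realType) (n : nat) (g : 'cV[R]_n -> R) :
    Prop :=
  exists m : R, forall x, m <= g x.

Definition coercive (R : realType) (n : nat) (g : 'cV[R]_n -> R) : Prop :=
  forall A : R, exists B : R, forall x, B <= enorm x -> A <= g x.

Definition twice_differentiable (R : realType) (n : nat) (g : 'cV[R]_n -> R)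
    (x : 'cV[R]_n) : Prop :=
  (\forall y \near x, differentiable g y) /\ differentiable (grad g) x.

Definition hessian (R : realType) (n : nat) (g : 'cV[R]_n -> R)
    (x : 'cV[R]_n) : 'M[R]_n :=
  \matrix_(i < n, j < n) ('D_(delta_mx j 0) (grad g) x) i 0.

Definition convex_hull (R : realType) (V : lmodType R) (A : set V) : set V :=
  [set v | exists (m : nat) (t : 'I_m -> R) (a : 'I_m -> V),
    [/\ forall i, 0 <= t i, \sum_(i < m) t i = 1, forall i, A (a i)
      & v = \sum_(i < m) t i *: a i]].

Definition gen_hessian (R : realType) (n : nat) (g : 'cV[R]_n -> R)
    (x : 'cV[R]_n) : set 'M[R]_n :=
  convex_hull [set H : 'M[R]_n | exists y : nat -> 'cV[R]_n,
    [/\ y k @[k --> \oo] --> x,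
        forall k, twice_differentiable g (y k)
      & hessian g (y k) @[k --> \oo] --> H]].

Definition objective (R : realType) (n : nat) (f : 'cV[R]_n -> R)
    (lambda q : R) (x : 'cV[R]_n) : R :=
  f x + lambda * lq q x.

(* E(x; T). *)
Definition sub_objective (R : realType) (n : nat) (f : 'cV[R]_n -> R)
    (lambda q : R) (T : {set 'I_n}) (x : 'cV[R]_n) : R :=
  f x + lambda * lq q (subvec T x).

(* nabla_S E(x) and partial^2_S E(x), with S = supp(x). *)
Definition sub_grad (R : realType) (n : nat) (f : 'cV[R]_n -> R)
    (lambda q : R) (x : 'cV[R]_n) : 'cV[R]_#|supp x| :=
  subvec (supp x) (grad (sub_objective f lambda q (supp x)) x).

Definition sub_gen_hessian (R : realType) (n : nat) (f : 'cV[R]_n -> R)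
    (lambda q : R) (x : 'cV[R]_n) : set 'M[R]_#|supp x| :=
  [set principal_submx (supp x) M
    | M in gen_hessian (sub_objective f lambda q (supp x)) x].
Arguments sub_gen_hessian {R n} f lambda q x _.

Definition prox (R : realType) (n : nat) (r : 'cV[R]_n -> R) (z : 'cV[R]_n) :
    set 'cV[R]_n :=
  [set w | forall v, 2^-1 * enorm (z - w) ^+ 2 + r w
                     <= 2^-1 * enorm (z - v) ^+ 2 + r v].

(* Prox_{alpha lambda ||.||_q^q}(x - alpha nabla f(x)). *)
Definition prox_grad (R : realType) (n : nat) (f : 'cV[R]_n -> R)
    (lambda q alpha : R) (x : 'cV[R]_n) : set 'cV[R]_n :=
  prox (fun v => alpha * lambda * lq q v) (x - alpha *: grad f x).

Definition P_stationary (R : realType) (n : nat) (f : 'cV[R]_n -> R)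
    (lambda q alpha : R) (x : 'cV[R]_n) : Prop :=
  prox_grad f lambda q alpha x x.

Definition level_set (R : realType) (n : nat) (f : 'cV[R]_n -> R)
    (lambda q : R) (x0 : 'cV[R]_n) : set 'cV[R]_n :=
  [set x | objective f lambda q x <= objective f lambda q x0].

(* The real-valued sup returns 0 on empty or unbounded sets.  For c0, the level
   set is bounded when f is continuously differentiable and bounded from below,
   lambda > 0, 0 <= q < 1, and f is coercive if q = 0; for sigma0, the Hessians
   are bounded when moreover f is LC1 on N(0, c0). *)
Definition c0 (R : realType) (n : nat) (f : 'cV[R]_n -> R)
    (lambda q tau : R) (x0 : 'cV[R]_n) : R :=
  sup [set 5 * (enorm x ^+ 2 + tau ^+ 2 * enorm (grad f x) ^+ 2
                + tau * lambda * lq q x)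
      | x in level_set f lambda q x0].

Definition sigma0 (R : realType) (n : nat) (f : 'cV[R]_n -> R)
    (lambda q tau : R) (x0 : 'cV[R]_n) : R :=
  sup [set sup [set specnorm H | H in gen_hessian f x]
      | x in nbhd 0 (c0 f lambda q tau x0)].

(* Step (i) from x with step size alpha.  The sufficient decrease is part of
   the step: alpha has to be such that it holds. *)
Definition prox_step (R : realType) (n : nat) (f : 'cV[R]_n -> R)
    (lambda q sigma alpha : R) (x w : 'cV[R]_n) : Prop :=
  prox_grad f lambda q alpha x w /\
  objective f lambda q w
    <= objective f lambda q x - sigma / 4 * enorm (w - x) ^+ 2.

Definition newton_direction (R : realType) (n : nat) (f : 'cV[R]_n -> R)
    (lambda q : R) (w : 'cV[R]_n) (M : 'M[R]_#|supp w|) (d : 'cV[R]_n) : Prop :=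
  M *m subvec (supp w) d = sub_grad f lambda q w /\
  subvec (~: supp w)%SET d = 0.
Arguments newton_direction {R n} f lambda q w M d.

Definition newton_decrease (R : realType) (n : nat) (f : 'cV[R]_n -> R)
    (lambda q sigma gamma : R) (w d : 'cV[R]_n) (s : int) : Prop :=
  objective f lambda q (w - gamma ^ s *: d)
    <= objective f lambda q w - sigma / 2 * enorm (gamma ^ s *: d) ^+ 2.

(* Step (ii) from w to x'.  If the linear system has solutions, d is any one of
   them, and the search for s is carried out along that d. *)
Definition newton_step (R : realType) (n : nat) (f : 'cV[R]_n -> R)
    (lambda q sigma gamma : R) (w x' : 'cV[R]_n) : Prop :=
  exists2 M, sub_gen_hessian f lambda q w M &
    (exists2 d, newton_direction f lambda q w M d &
       (exists2 s, newton_decrease f lambda q sigma gamma w d s &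
          x' = w - gamma ^ s *: d) \/
       ((forall s, ~ newton_decrease f lambda q sigma gamma w d s) /\ x' = w))
    \/ ((forall d, ~ newton_direction f lambda q w M d) /\ x' = w).

Definition PSNP (R : realType) (n : nat) (f : 'cV[R]_n -> R)
    (lambda q sigma gamma : R) (alpha : nat -> R) (x0 : 'cV[R]_n)
    (w x : nat -> 'cV[R]_n) : Prop :=
  x 0%N = x0 /\
  forall k, prox_step f lambda q sigma (alpha k) (x k) (w k) /\
            newton_step f lambda q sigma gamma (w k) (x k.+1).

Definition PCSNP (R : realType) (n : nat) (f : 'cV[R]_n -> R)
    (lambda q sigma gamma : R) (alpha : nat -> R) (x0 : 'cV[R]_n)
    (w x : nat -> 'cV[R]_n) : Prop :=
  x 0%N = x0 /\
  forall k, prox_step f lambda q sigma (alpha k) (x k) (w k) /\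
            (if supp (w k) == supp (x k)
             then newton_step f lambda q sigma gamma (w k) (x k.+1)
             else x k.+1 = w k).

(* Main.v *)
Require Import Defs.
From HB Require Import structures.
From mathcomp Require Import all_boot all_order all_algebra.
From mathcomp Require Import all_classical all_reals all_analysis.

Set Implicit Arguments.
Unset Strict Implicit.
Unset Printing Implicit Defensive.

Import Order.TTheory GRing.Theory Num.Theory.
Import numFieldNormedType.Exports.
Local Open Scope classical_set_scope.
Local Open Scope ring_scope.

(** The values F(x^k), F(w^k) interlace decreasingly and are bounded below, so
    F(x^k) converges; each half step pays a multiple of its squared length,
    hence both half steps tend to 0.  The optimality of w^k in the proximal
    problem then passes to the limit at an accumulation point, because the
    gradient is continuous and the q-norm is lower semicontinuous: near x*, it
    dominates its restriction to supp x*, which is continuous at x*. *)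

Lemma cvgr_near_lt (R : realFieldType) (T : Type) (F : set_system T)
    (u v : T -> R) (a b : R) : Filter F ->
  u t @[t --> F] --> a -> v t @[t --> F] --> b -> a < b ->
  \forall t \near F, u t < v t.
Proof.
move=> FF ua vb /midf_lt[am mb].
apply: filterS2 (cvgr_lt _ ua _ am) (cvgr_gt _ vb _ mb) => t; exact: lt_trans.
Qed.

Lemma enorm_sqr (R : realType) (n : nat) (x : 'cV[R]_n) :
  enorm x ^+ 2 = \sum_(i < n) x i 0 ^+ 2.
Proof. by rewrite sqr_sqrtr// sumr_ge0// => i _; exact: sqr_ge0. Qed.

Lemma enorm0 (R : realType) (n : nat) : enorm (0 : 'cV[R]_n) = 0.
Proof. by rewrite /enorm big1 ?sqrtr0// => i _; rewrite mxE expr0n. Qed.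

Lemma enormN (R : realType) (n : nat) (x : 'cV[R]_n) : enorm (- x) = enorm x.
Proof. by congr Num.sqrt; apply: eq_bigr => i _; rewrite mxE sqrrN. Qed.

Lemma mx_norm_le_enorm (R : realType) (n : nat) (x : 'cV[R]_n) :
  `|x| <= enorm x.
Proof.
rewrite [leLHS]/Num.Def.normr/= mx_normrE bigmax_le ?sqrtr_ge0//.
move=> [i j] _ /=; rewrite (ord1 j) -sqrtr_sqr ler_wsqrtr//.
by rewrite (bigD1 i)//= lerDl sumr_ge0// => k _; exact: sqr_ge0.
Qed.

(** Convergence in the topology of ['cV[R]_n] is governed by the sup norm, which the Euclidean norm
    dominates; so [u k] is squeezed by the square root of [e k / c]. *)
Lemma cvg_enorm_sqr_le (R : realType) (n : nat) (c : R) (u : nat -> 'cV[R]_n)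
    (e : nat -> R) :
    0 < c -> (forall k, c * enorm (u k) ^+ 2 <= e k) ->
  e k @[k --> \oo] --> (0 : R) -> u k @[k --> \oo] --> (0 : 'cV[R]_n).
Proof.
move=> c_gt0 ue e0; apply: norm_cvg0.
apply: (@squeeze_cvgr _ _ _ _ (fun=> 0) (fun k => Num.sqrt (c^-1 * e k))).
- near=> k; rewrite normr_ge0/= (le_trans (mx_norm_le_enorm _))//.
  by rewrite -[leLHS]ger0_norm ?sqrtr_ge0// -sqrtr_sqr ler_wsqrtr// ler_pdivlMl.
- exact: cvg_cst.
- rewrite -[X in _ --> X]sqrtr0 -[X in Num.sqrt X](mulr0 c^-1).
  apply: (continuous_cvg _ (h := Num.sqrt)); first exact: sqrt_continuous.
  by apply: cvgMr.
Unshelve. all: by end_near. Qed.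

Lemma cvg_enorm_sqr (R : realType) (n : nat) (T : Type) (F : set_system T)
    (u : T -> 'cV[R]_n) (a : 'cV[R]_n) : Filter F ->
  u t @[t --> F] --> a -> enorm (u t) ^+ 2 @[t --> F] --> enorm a ^+ 2.
Proof.
move=> FF ua; rewrite enorm_sqr; under eq_cvg do rewrite enorm_sqr.
apply: cvg_big => [|i _]; first exact: add_continuous.
have ui : u t i 0 @[t --> F] --> a i 0.
  by apply: (continuous_cvg _ (h := fun v : 'cV_n => v i 0)) => //;
    exact: coord_continuous.
exact: cvgM.
Qed.

(** The index set is frozen here, whereas the one of [lq] moves with [x]: this gives a lower bound
    of [lq] near a point that is continuous there. *)
Definition lq_on (R : realType) (q : R) (n : nat) (T : {set 'I_n})
    (x : 'cV[R]_n) : R :=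
  \sum_(i in T) `|x i 0| `^ q.

Lemma lq_on_supp (R : realType) (q : R) (n : nat) (x : 'cV[R]_n) :
  lq_on q (supp x) x = lq q x.
Proof. by apply: eq_bigl => i; rewrite inE. Qed.

Lemma lq_ge0 (R : realType) (q : R) (n : nat) (x : 'cV[R]_n) : 0 <= lq q x.
Proof. by apply: sumr_ge0 => i _; exact: powR_ge0. Qed.

Lemma lq_on_le (R : realType) (q : R) (n : nat) (T : {set 'I_n})
    (x : 'cV[R]_n) :
  T \subset supp x -> lq_on q T x <= lq q x.
Proof.
move=> /fintype.subsetP Tx; rewrite -lq_on_supp /lq_on.
rewrite [leRHS](bigID (mem T))/= [X in _ <= X + _](eq_bigl (mem T)) => [|i].
  by rewrite lerDl sumr_ge0// => i _; exact: powR_ge0.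
by rewrite /= andbC; case: (boolP (i \in T)) => //= /Tx.
Qed.

Lemma near_supp (R : realType) (n : nat) (T : Type) (F : set_system T)
    (u : T -> 'cV[R]_n) (a : 'cV[R]_n) : Filter F ->
  u t @[t --> F] --> a -> \forall t \near F, supp a \subset supp (u t).
Proof.
move=> FF ua.
have H i : i \in supp a -> \forall t \near F, u t i 0 != 0.
  rewrite inE => ai.
  have ui : u t i 0 @[t --> F] --> a i 0.
    by apply: (continuous_cvg _ (h := fun v : 'cV_n => v i 0)) => //;
      exact: coord_continuous.
  exact: (cvgr_neq0 _ ui).
have : \forall t \near F, forall i, i \in supp a -> u t i 0 != 0.
  (* Only finitely many coordinates are involved, so the neighbourhoods can be intersected. *)
  apply: filter_forall => i.
  by have [/H|ia] := boolP (i \in supp a); [apply: filterS | near=> t].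
by apply: filterS => t ut; apply/fintype.subsetP => i /ut; rewrite inE.
Unshelve. all: by end_near. Qed.

Lemma cvg_lq_on (R : realType) (q : R) (n : nat) (T : Type) (F : set_system T)
    (u : T -> 'cV[R]_n) (a : 'cV[R]_n) : Filter F ->
  u t @[t --> F] --> a ->
  lq_on q (supp a) (u t) @[t --> F] --> lq q a.
Proof.
move=> FF ua; rewrite -lq_on_supp.
apply: cvg_big => [|i]; first exact: add_continuous.
rewrite inE => ai.
apply: (continuous_cvg _ (h := fun s : R => s `^ q)); last first.
  apply: cvg_norm.
  by apply: (continuous_cvg _ (h := fun v : 'cV_n => v i 0)) => //;
    exact: coord_continuous.
(* On the support of [a] the base of the power is positive, where the power is smooth whatever the
   exponent. *)
apply/differentiable_continuous/derivable1_diffP/derivable_powR.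
by rewrite in_itv/= andbT normr_gt0.
Qed.

(** This replaces the extraction of a subsequence: a single index with the pair close to [(a, a)] is
    enough to contradict an inequality that holds for all [k]. *)
Lemma cluster_near_prod (R : realType) (V : normedModType R)
    (x w : nat -> V) (a : V) (P : set (V * V)) :
    cluster (x k @[k --> \oo]) a -> w k - x k @[k --> \oo] --> (0 : V) ->
  nbhs (a, a) P -> exists k, P (x k, w k).
Proof.
move=> xa wx [[A B] /= [Aa Ba] ABP].
have /nbhs_ballP[e /= e0 eB] := Ba.
have e20 : 0 < e / 2 by rewrite divr_gt0.
have wxe : \forall k \near \oo, `|w k - x k| < e / 2.
  by apply: (@cvgr0_norm_lt _ _ _ _ _ _ wx).
(* Clustering is tested on the image of the good indices, so that the point found near [a] comes
   with an index at which [w k] is near [x k]. *)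
have [] := xa (x @` [set k | `|w k - x k| < e / 2]) (A `&` ball a (e / 2)).
- by apply: filterS wxe => k ?; exists k.
- by apply: filterI => //; exact: nbhsx_ballx.
move=> _ [[k /= wk <-] [Ak ak]]; exists k; apply: ABP; split => //=.
apply: eB; rewrite [e]splitr; apply: (ball_triangle ak).
by rewrite -ball_normE/= distrC.
Qed.

Lemma cluster_P_stationary (R : realType) (n : nat) (f : 'cV[R]_n -> R)
    (lambda q alpha : R) (w x : nat -> 'cV[R]_n) (a : 'cV[R]_n) :
    0 <= lambda -> 0 <= alpha -> {for a, continuous (grad f)} ->
    (forall k, prox_grad f lambda q alpha (x k) (w k)) ->
    w k - x k @[k --> \oo] --> (0 : 'cV[R]_n) ->
  cluster (x k @[k --> \oo]) a -> P_stationary f lambda q alpha a.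
Proof.
move=> lambda0 alpha0 fa xw wx xa v; rewrite leNgt; apply/negP => va.
pose z (y : 'cV[R]_n) := y - alpha *: grad f y.
(* The penalty is restricted to [supp a] to make [lhs] continuous at [(a, a)], where it still takes
   the value of the true proximal objective. *)
pose lhs (p : 'cV[R]_n * 'cV[R]_n) :=
  2^-1 * enorm (z p.1 - p.2) ^+ 2 + alpha * lambda * lq_on q (supp a) p.2.
pose rhs (p : 'cV[R]_n * 'cV[R]_n) :=
  2^-1 * enorm (z p.1 - v) ^+ 2 + alpha * lambda * lq q v.
have p1 : p.1 @[p --> (a, a)] --> a by exact: cvg_fst.
have p2 : p.2 @[p --> (a, a)] --> a by exact: cvg_snd.
have pz : z p.1 @[p --> (a, a)] --> z a.
  apply: cvgB => //; apply: cvgZr.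
  exact: (continuous_cvg _ (h := grad f)).
have pl : lhs p @[p --> (a, a)] -->
    2^-1 * enorm (z a - a) ^+ 2 + alpha * lambda * lq q a.
  apply: cvgD; apply: cvgMr.
    by apply: cvg_enorm_sqr; apply: cvgB.
  exact: cvg_lq_on.
have pr : rhs p @[p --> (a, a)] -->
    2^-1 * enorm (z a - v) ^+ 2 + alpha * lambda * lq q v.
  apply: cvgD; last exact: cvg_cst.
  apply: cvgMr; apply: cvg_enorm_sqr; apply: cvgB => //; exact: cvg_cst.
have near_lt : \forall p \near (a, a), rhs p < lhs p.
  exact: cvgr_near_lt pr pl va.
have [k [/= kd ks]] := cluster_near_prod xa wx
  (filterI near_lt (near_supp _ p2)).
(* Restoring the full penalty only increases the larger side, so [v] strictly beats [w k] in its own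
   proximal problem. *)
have := lt_le_trans kd (lerD (lexx _)
  (ler_wpM2l (mulr_ge0 alpha0 lambda0) (lq_on_le q ks))).
by rewrite ltNge xw.
Qed.

Lemma newton_step_decrease (R : realType) (n : nat) (f : 'cV[R]_n -> R)
    (lambda q sigma gamma : R) (w x' : 'cV[R]_n) :
  newton_step f lambda q sigma gamma w x' ->
  objective f lambda q x'
    <= objective f lambda q w - sigma / 2 * enorm (x' - w) ^+ 2.
Proof.
have stay : objective f lambda q w
    <= objective f lambda q w - sigma / 2 * enorm (w - w) ^+ 2.
  by rewrite subrr enorm0 expr0n mulr0 subr0.
case=> M _ [[d _ [[s ws ->]|[_ ->]]]|[_ ->]] //.
by rewrite (addrAC w) subrr add0r enormN.
Qed.

(** Both algorithms enter the convergence proof only through these inequalities; a skipped Newton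
    step satisfies the second one trivially. *)
Lemma PSNP_PCSNP_decrease (R : realType) (n : nat) (f : 'cV[R]_n -> R)
    (lambda q sigma gamma : R) (alpha : nat -> R) (x0 : 'cV[R]_n)
    (w x : nat -> 'cV[R]_n) :
  PSNP f lambda q sigma gamma alpha x0 w x \/
    PCSNP f lambda q sigma gamma alpha x0 w x ->
  forall k, prox_step f lambda q sigma (alpha k) (x k) (w k) /\
    objective f lambda q (x k.+1) <= objective f lambda q (w k)
      - sigma / 2 * enorm (x k.+1 - w k) ^+ 2.
Proof.
case=> -[_ gen] k; have [xw wx] := gen k; split=> //.
  exact: newton_step_decrease wx.
move: wx; case: ifP => _; first exact: newton_step_decrease.
by move->; rewrite subrr enorm0 expr0n mulr0 subr0.
Qed.

(* `|grad f 0| is the sup norm of the gradient. *)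
Theorem lemma4p3 (R : realType) (n : nat) (f : 'cV[R]_n -> R)
    (lambda q tau sigma gamma alpha : R) (x0 : 'cV[R]_n)
    (w x : nat -> 'cV[R]_n)
    (f_C1 : continuously_differentiable_on setT f)
    (f_bounded : bounded_from_below f)
    (lambda_gt0 : 0 < lambda)
    (q_ge0 : 0 <= q) (q_lt1 : q < 1)
    (tau_gt0 : 0 < tau)
    (sigma_gt0 : 0 < sigma)
    (gamma_gt0 : 0 < gamma) (gamma_lt1 : gamma < 1)
    (alpha_gt0 : 0 < alpha)
    (alpha_le : alpha <= Num.min tau (1 / (sigma + sigma0 f lambda q tau x0)))
    (grad0_neq0 : grad f 0 != 0)
    (lambda_lt : lambda < alpha `^ (1 - q) / 2 * `|grad f 0| `^ (2 - q))
    (f_LC1 : LC1 (nbhd 0 (c0 f lambda q tau x0)) f)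
    (f_coercive : q = 0 -> coercive f)
    (generated : PSNP f lambda q sigma gamma (fun=> alpha) x0 w x \/
                 PCSNP f lambda q sigma gamma (fun=> alpha) x0 w x) :
  [/\ cvgn (fun k => objective f lambda q (x k)),
      w k - x k @[k --> \oo] --> (0 : 'cV[R]_n),
      x k.+1 - x k @[k --> \oo] --> (0 : 'cV[R]_n)
    & forall xstar : 'cV[R]_n, cluster (x k @[k --> \oo]) xstar ->
        P_stationary f lambda q alpha xstar].
Proof.
have step := PSNP_PCSNP_decrease generated.
pose F k := objective f lambda q (x k).
pose G k := objective f lambda q (w k).
have GF k : sigma / 4 * enorm (w k - x k) ^+ 2 <= F k - G k.
  by rewrite lerBrDl -lerBrDr; have [[]] := step k.
have FG k : sigma / 2 * enorm (x k.+1 - w k) ^+ 2 <= G k - F k.+1.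
  by rewrite lerBrDl -lerBrDr; have [] := step k.
have leGF k : G k <= F k.
  by rewrite -subr_ge0 (le_trans _ (GF k))// mulr_ge0 ?sqr_ge0// divr_ge0// ltW.
have leFG k : F k.+1 <= G k.
  by rewrite -subr_ge0 (le_trans _ (FG k))// mulr_ge0 ?sqr_ge0// divr_ge0// ltW.
have cvgF : cvgn F.
  apply: nonincreasing_is_cvgn.
    by apply/nonincreasing_seqP => k; exact: le_trans (leFG k) (leGF k).
  have [m fm] := f_bounded; exists m => _ [k _ <-].
  by rewrite (le_trans (fm (x k)))// lerDl mulr_ge0 ?lq_ge0// ltW.
(* Since [G k] lies between [F k.+1] and [F k], this drop bounds the cost of each of the two half
   steps. *)
have drop0 : F k - F k.+1 @[k --> \oo] --> (0 : R).
  by rewrite -(subrr (limn F)); apply: cvgB => //; rewrite cvg_shiftS.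
have wx0 : w k - x k @[k --> \oo] --> (0 : 'cV[R]_n).
  apply: (@cvg_enorm_sqr_le _ _ (sigma / 4) _ _ _ _ drop0).
    exact: divr_gt0.
  by move=> k; rewrite (le_trans (GF k))// lerB.
have xw0 : x k.+1 - w k @[k --> \oo] --> (0 : 'cV[R]_n).
  apply: (@cvg_enorm_sqr_le _ _ (sigma / 2) _ _ _ _ drop0).
    exact: divr_gt0.
  by move=> k; rewrite (le_trans (FG k))// lerB.
split=> // [|a xa].
  rewrite -[0 in X in _ --> X](addr0 0).
  under eq_cvg => k do rewrite -[x k.+1](subrK (w k)) -addrA.
  exact: cvgD.
apply: (@cluster_P_stationary _ _ _ _ _ _ w x) => //; try exact: ltW.
  by have [] := f_C1 a.
by move=> k; have [[]] := step k.
Qed.
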